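(* Let $p>0$, $q>0$ be integers such that $27q^2-4p^3>0$. For $n\ge 0$ define \[ a_n=\sum_{\substack{i,j\ge 0\\ 2i+3j\le n}}\binom{i+j}{j}\binom{n-i-2j}{i+j}3^{\,n-2i-3j}(p-3)^{i}(q-p+1)^{j}. \] Then \[ -1+\lim_{n\to\infty}\frac{a_n}{a_{n-1}}=\frac{(2/3)^{1/3}\,p}{\left(9q+\sqrt{81q^2-12p^3}\right)^{1/3}}+\frac{\left(9q+\sqrt{81q^2-12p^3}\right)^{1/3}}{2^{1/3}3^{2/3}}, \] which is the real root of $f(x)=x^3-px-q$. *)

(* Defs.v *)
From mathcomp Require Import all_boot all_order all_algebra.
From mathcomp Require Import all_classical all_reals all_analysis.

Set Implicit Arguments.
Unset Strict Implicit.
Unset Printing Implicit Defensive.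

Import Order.TTheory GRing.Theory Num.Theory.

Local Open Scope ring_scope.

(* The constraint [2 * i + 3 * j <= n] forces [i, j <= n], so bounding both
   indices by [n] loses no term; under it the truncated subtractions below are
   exact.  The base [p - 3] or [q - p + 1] may be [0], and [0 ^+ 0 = 1]. *)
Definition cubic_seq (p q : int) (n : nat) : int :=
  \sum_(i < n.+1) \sum_(j < n.+1 | (2 * i + 3 * j <= n)%N)
    ('C(i + j, j))%:Z * ('C(n - i - 2 * j, i + j))%:Z
    * 3 ^+ (n - 2 * i - 3 * j) * (p - 3) ^+ i * (q - p + 1) ^+ j.

Definition depressed_cubic (R : realType) (p q : int) : {poly R} :=
  'X^3 - (p%:~R)%:P * 'X - (q%:~R)%:P.

(* When [0 < q], the bases [2 / 3], [w], [2] and [3] are positive, so [`^] is the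
   usual real power ([powR]); the radicand is [3 * (27 * q ^+ 2 - 4 * p ^+ 3)],
   so [Num.sqrt] does not fall back to its default value [0] as long as
   [4 * p ^+ 3 < 27 * q ^+ 2]. *)
Definition cardano_root (R : realType) (p q : int) : R :=
  let w : R := 9 * q%:~R + Num.sqrt (81 * q%:~R ^+ 2 - 12 * p%:~R ^+ 3) in
  (2 / 3) `^ (1 / 3) * p%:~R / w `^ (1 / 3)
  + w `^ (1 / 3) / (2 `^ (1 / 3) * 3 `^ (2 / 3)).

(* Main.v *)
Require Import Defs.
From mathcomp Require Import all_boot all_order all_algebra.
From mathcomp Require Import all_classical all_reals all_analysis.
From mathcomp Require Import zify ring lra.

(* [a_n] counts the compositions of [n] with parts 1, 2, 3 weighted by 3, [p - 3]
   and [q - p + 1], so it satisfies the linear recurrence with characteristic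
   polynomial [f(y - 1)]. As [27 q^2 > 4 p^3], [f] has one real root [r > 0] and
   two conjugate ones; shifted by 1, the latter have squared modulus
   [r^2 - p - r + 1 < (r + 1)^2], so [r + 1] dominates, and its coefficient in
   [a_n] is nonzero. Complex numbers are avoided by factoring the recurrence as
   the real root [r + 1] times a quadratic with negative discriminant. *)

Set Implicit Arguments.
Unset Strict Implicit.
Unset Printing Implicit Defensive.

Import Order.TTheory GRing.Theory Num.Theory.
Import numFieldNormedType.Exports.

Local Open Scope classical_set_scope.
Local Open Scope ring_scope.

(** * Weighted compositions and the recurrence for [cubic_seq] *)

(** The multinomial coefficient (m+i+j)!/(m! i! j!), factored as in the summand of [cubic_seq],
    where m = n-2i-3j. *)
Definition trinomial (m i j : nat) : nat := 'C(i + j, j) * 'C(m + (i + j), i + j).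

(** Pascal's rule: a nonempty word with m, i, j copies of three letters is classified by its first
    letter. *)
Lemma trinomial_recl m i j : (0 < m + i + j)%N ->
  trinomial m i j = ((if m is m'.+1 then trinomial m' i j else 0)
    + (if i is i'.+1 then trinomial m i' j else 0)
    + (if j is j'.+1 then trinomial m i j' else 0))%N.
Proof.
rewrite /trinomial; case: i => [|i]; case: j => [|j]; case: m => [|m] //= _;
  rewrite ?(add0n, addn0, addSn, addnS, bin0, binn, muln1, mul1n, binS); lia.
Qed.

Section WeightedCompositions.
Variables (K : comNzRingType) (x y z : K).

Definition composition_term (n i j : nat) : K :=
  if (2 * i + 3 * j <= n)%N then
    (trinomial (n - 2 * i - 3 * j) i j)%:R * x ^+ (n - 2 * i - 3 * j)
      * y ^+ i * z ^+ j
  else 0.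

(** The box size [N] is independent of [n], so that the recurrence compares sums over one common
    box. *)
Definition composition_sum (N n : nat) : K :=
  \sum_(0 <= i < N) \sum_(0 <= j < N) composition_term n i j.

Lemma composition_termE m i j : composition_term (m + 2 * i + 3 * j) i j =
  (trinomial m i j)%:R * x ^+ m * y ^+ i * z ^+ j.
Proof.
rewrite /composition_term ifT; last lia.
by congr (_%:R * x ^+ _ * _ * _); [congr (trinomial _ _ _) |]; lia.
Qed.

Lemma composition_term_gt n i j : (n < 2 * i + 3 * j)%N ->
  composition_term n i j = 0.
Proof. by move=> ltn; rewrite /composition_term leqNgt ltn. Qed.

(** Removing the first part, of size 1, 2 or 3, from a composition of n+3. *)
Lemma composition_term_rec n i j : composition_term n.+3 i j =
  x * composition_term n.+2 i j
  + (if i is i'.+1 then y * composition_term n.+1 i' j else 0)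
  + (if j is j'.+1 then z * composition_term n i j' else 0).
Proof.
have [le_n|lt_n] := leqP (2 * i + 3 * j) n.+3; last first.
  rewrite !composition_term_gt ?mulr0 ?add0r; try lia.
  by case: i j lt_n => [|i] [|j] lt_n; rewrite ?composition_term_gt ?mulr0 ?addr0 //; lia.
have [m defm] : {m | n.+3 = m + 2 * i + 3 * j}%N.
  by exists (n.+3 - 2 * i - 3 * j)%N; lia.
rewrite defm composition_termE trinomial_recl; last lia.
rewrite !natrD !mulrDl; congr (_ + _ + _).
- case: m defm => [|m] defm; first by rewrite !mul0r composition_term_gt ?mulr0 //; lia.
  have -> : n.+2 = (m + 2 * i + 3 * j)%N by lia.
  by rewrite composition_termE exprS; ring.
- case: i {le_n} defm => [|i] defm; first by rewrite !mul0r.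
  have -> : n.+1 = (m + 2 * i + 3 * j)%N by lia.
  by rewrite composition_termE exprS; ring.
- case: j {le_n} defm => [|j] defm; first by rewrite !mul0r.
  have -> : n = (m + 2 * i + 3 * j)%N by lia.
  by rewrite composition_termE exprS; ring.
Qed.

Lemma composition_sum_rec N n : (n.+3 < N)%N -> composition_sum N n.+3 =
  x * composition_sum N n.+2 + y * composition_sum N n.+1
  + z * composition_sum N n.
Proof.
case: N => // N lt_nN; rewrite /composition_sum.
under eq_bigr do under eq_bigr do rewrite composition_term_rec.
under eq_bigr do rewrite !big_split /=.
rewrite !big_split /= !mulr_sumr; congr (_ + _ + _).
- by apply: eq_bigr => i _; rewrite mulr_sumr.
- rewrite big_nat_recl // big1 // add0r [RHS]big_nat_recr //=.
  (* The index shift loses only the row i = N, which vanishes as 2N > n+1. *)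
  rewrite [X in _ = _ + y * X]big1 ?mulr0 ?addr0; last first.
    by move=> j _; rewrite composition_term_gt //; lia.
  by apply: eq_bigr => i _; rewrite mulr_sumr.
- apply: eq_bigr => i _; rewrite big_nat_recl // add0r [in RHS]big_nat_recr //=.
  rewrite composition_term_gt ?addr0; last lia.
  by rewrite mulr_sumr.
Qed.

Lemma composition_sum_widen N n : (n < N)%N ->
  composition_sum N n = composition_sum n.+1 n.
Proof.
move=> lt_nN; rewrite /composition_sum [LHS](big_cat_nat (n := n.+1)) //=.
rewrite [X in _ + X]big_nat_cond [X in _ + X]big1 ?addr0; last first.
  move=> i /andP[/andP[le_i _] _]; rewrite big1 // => j _.
  by rewrite composition_term_gt //; lia.
apply: eq_bigr => i _; rewrite [LHS](big_cat_nat (n := n.+1)) //=.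
rewrite [X in _ + X]big_nat_cond [X in _ + X]big1 ?addr0 //.
by move=> j /andP[/andP[le_j _] _]; rewrite composition_term_gt //; lia.
Qed.

End WeightedCompositions.

Lemma cubic_seqE p q n :
  cubic_seq p q n = composition_sum 3 (p - 3) (q - p + 1) n.+1 n.
Proof.
rewrite /composition_sum big_mkord; apply: eq_bigr => i _.
rewrite big_mkord big_mkcond /=; apply: eq_bigr => j _.
rewrite /composition_term; case: ifP => // le_n; rewrite /trinomial.
congr (_ * _ * _ * _); rewrite natrM !natz; congr (_ * _); congr (Posz 'C(_, _)); lia.
Qed.

Lemma cubic_seq_rec p q n : cubic_seq p q n.+3 =
  3 * cubic_seq p q n.+2 + (p - 3) * cubic_seq p q n.+1
  + (q - p + 1) * cubic_seq p q n.
Proof.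
rewrite !cubic_seqE composition_sum_rec //.
by rewrite !(@composition_sum_widen _ _ _ _ n.+4) //; lia.
Qed.

Lemma cubic_seq_init p q :
  [/\ cubic_seq p q 0 = 1, cubic_seq p q 1 = 3 & cubic_seq p q 2 = p + 6].
Proof.
rewrite !cubic_seqE /composition_sum !big_mkord.
split; rewrite !big_ord_recr !big_ord0 /= !big_mkord !big_ord_recr !big_ord0
  /= /composition_term /trinomial /= ?(bin0, bin1, mul1r, mulr1, expr0, expr1).
all: ring.
Qed.

(** * Linear recurrences with a dominant real root *)

(* The quadratic form [b_(n+1)^2 - c b_n b_(n+1) + d b_n^2] is positive definite
   and is multiplied by [d] at each step. *)
Lemma order2_rec_sqr_bound (R : realFieldType) (b : nat -> R) (c d : R) :
  c ^+ 2 < 4 * d -> (forall n, b n.+2 = c * b n.+1 - d * b n) ->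
  exists C, forall n, b n ^+ 2 <= C * d ^+ n.
Proof.
move=> lt_cd recb; pose E n := b n.+1 ^+ 2 - c * b n * b n.+1 + d * b n ^+ 2.
have EE n : E n = E 0%N * d ^+ n.
  elim: n => [|n IHn]; first by rewrite mulr1.
  by rewrite exprS mulrCA -IHn /E recb; ring.
(* Completing the square: E_n = (b_(n+1) - (c/2) b_n)^2 + (d - c^2/4) b_n^2. *)
have k_gt0 : 0 < d - c ^+ 2 / 4 by lra.
exists (E 0%N / (d - c ^+ 2 / 4)) => n.
rewrite mulrAC -EE ler_pdivlMr //.
have := sqr_ge0 (b n.+1 - c / 2 * b n); rewrite /E; nra.
Qed.

Lemma cvg0_sqr (R : realType) (s : R^nat) :
  (fun n => s n ^+ 2) @ \oo --> 0 -> s @ \oo --> 0.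
Proof.
move=> s2_0; apply/norm_cvg0P.
rewrite -[0]sqrtr0; under eq_fun do rewrite -sqrtr_sqr.
exact: (continuous_cvg _ (@sqrt_continuous R 0) s2_0).
Qed.

(* With [b_n = a_(n+1) - rho a_n], the solution splits as
   [(rho^2 - c rho + d) a_n = L_0 rho^n - (b_(n+1) + (rho - c) b_n)]. *)
Lemma dominant_root_ratio (R : realType) (a : R^nat) (rho c d : R) :
  0 < rho -> c ^+ 2 < 4 * d -> d < rho ^+ 2 ->
  (forall n, a n.+3 = (rho + c) * a n.+2 - (rho * c + d) * a n.+1 + rho * d * a n) ->
  a 2%N - c * a 1%N + d * a 0%N != 0 ->
  (fun n => a n.+1 / a n) @ \oo --> rho.
Proof.
move=> rho_gt0 lt_cd lt_dr reca; set L0 := (X in X != 0) => L0_neq0.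
have rho_neq0 : rho != 0 by rewrite gt_eqF.
pose b n := a n.+1 - rho * a n.
have recb n : b n.+2 = c * b n.+1 - d * b n by rewrite /b reca; ring.
have [C leb] := order2_rec_sqr_bound lt_cd recb.
have d_gt0 : 0 < d by nra.
pose s n := b n / rho ^+ n.
have s_0 : s @ \oo --> 0.
  apply: cvg0_sqr.
  apply: (@squeeze_cvgr _ _ _ _ (fun=> 0) (fun n => C * (d / rho ^+ 2) ^+ n)).
  - apply: nearW => n; rewrite sqr_ge0 /s exprMn exprVn expr_div_n mulrA /=.
    rewrite -exprM [(n * 2)%N]mulnC exprM.
    by rewrite ler_wpM2r // invr_ge0 exprn_ge0 // exprn_ge0 // ltW.
  - exact: cvg_cst.
  - rewrite -[X in _ --> X](mulr0 C); apply: cvgMl_tmp; apply: cvg_expr.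
    rewrite ger0_norm; last by rewrite divr_ge0 ?exprn_ge0 ?ltW.
    by rewrite ltr_pdivrMr ?exprn_gt0 // mul1r.
(* The characteristic polynomial is (X - rho)(X^2 - cX + d). Applying the quadratic factor to [a]
   leaves a geometric sequence of ratio rho. *)
pose L n := a n.+2 - c * a n.+1 + d * a n.
have LE n : L n = L0 * rho ^+ n.
  elim: n => [|n IHn]; first by rewrite mulr1.
  by rewrite exprS mulrCA -IHn /L reca; ring.
(* The value at rho of the quadratic factor, positive by its negative discriminant. *)
pose k := rho ^+ 2 - c * rho + d.
have k_gt0 : 0 < k by rewrite /k; nra.
have k_neq0 : k != 0 by rewrite gt_eqF.
pose t n := a n / rho ^+ n.
have tE n : t n = (L0 - (rho * s n.+1 + (rho - c) * s n)) / k.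
  have rn : rho ^+ n != 0 by rewrite expf_neq0.
  have L0E : L0 = L n / rho ^+ n by rewrite LE mulfK.
  rewrite L0E /t /s /L /b exprS; move: (rho ^+ n) rn k_neq0 => r rn; rewrite /k => k0.
  by field; rewrite k0 rn.
have t_l : t @ \oo --> L0 / k.
  have -> : t = fun n => (L0 - (rho * s n.+1 + (rho - c) * s n)) / k by exact/funext.
  rewrite -[in X in _ --> X](subr0 L0).
  apply: cvgMr_tmp; apply: cvgB; first exact: cvg_cst.
  have s1_0 : s n.+1 @[n --> \oo] --> 0 by rewrite (cvg_shiftS s); exact: s_0.
  have := cvgD (cvgMl_tmp (a := rho) s1_0) (cvgMl_tmp (a := rho - c) s_0).
  by rewrite !mulr0 addr0; apply.
have l_neq0 : L0 / k != 0 by rewrite mulf_neq0 ?invr_eq0.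
(* This holds at every n, even where a_n = 0, because the inverse of 0 is 0. *)
have -> : (fun n => a n.+1 / a n) = (fun n => rho * (t n.+1 / t n)).
  apply/funext => n; rewrite /t exprS !invfM !invrK.
  have rn : rho ^+ n != 0 by rewrite expf_neq0.
  have -> : rho * (a n.+1 * (rho^-1 / rho ^+ n) * ((a n)^-1 * rho ^+ n))
     = a n.+1 / a n * (rho / rho) * (rho ^+ n / rho ^+ n) by ring.
  by rewrite !divff // !mulr1.
rewrite -[X in _ --> X]mulr1 -(divff l_neq0).
apply: cvgMl_tmp; apply: cvgM; first by rewrite (cvg_shiftS t); exact: t_l.
exact: cvgV.
Qed.

(** * Cardano's formula and the real root *)

Lemma powR_inv_exp (R : realType) (x : R) (n : nat) : (0 < n)%N -> 0 <= x ->
  (x `^ (1 / n%:R)) ^+ n = x.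
Proof.
move=> n_gt0 x_ge0; rewrite -powR_mulrn ?powR_ge0 // -powRrM mul1r mulVf ?powRr1 //.
by rewrite pnatr_eq0 -lt0n.
Qed.

(* Cardano's substitution [v + p / (3 v)], with [v^3 = w / 18]. *)
Lemma cardano_rootE (R : realType) (p q : int) : 0 < q -> 4 * p ^+ 3 < 27 * q ^+ 2 ->
  exists v : R, [/\ 0 < v, cardano_root R p q = v + p%:~R / (3 * v)
    , v ^+ 3 - q%:~R + p%:~R ^+ 3 / (27 * v ^+ 3) = 0 & q%:~R / 2 < v ^+ 3].
Proof.
move=> q_gt0 lt_pq; rewrite /cardano_root.
have Q_gt0 : 0 < q%:~R :> R by rewrite ltr0z.
have lt_PQ : 4 * p%:~R ^+ 3 < 27 * q%:~R ^+ 2 :> R.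
  by move: lt_pq; rewrite -(ltr_int R) 2!intrM 2!rmorphXn.
move: (p%:~R : R) (q%:~R : R) Q_gt0 lt_PQ => P Q Q_gt0 lt_PQ /=.
set D := 81 * _ - _; set S := Num.sqrt D; set w := 9 * Q + S.
have D_gt0 : 0 < D by rewrite /D; lra.
have S_gt0 : 0 < S by rewrite sqrtr_gt0.
have S2 : S ^+ 2 = D by rewrite sqr_sqrtr // ltW.
have w_gt0 : 0 < w by rewrite /w; lra.
have pow3 (x : R) : 0 <= x -> (x `^ (1 / 3)) ^+ 3 = x by apply: powR_inv_exp.
(* All radicals are expressed through the cube roots of 2, 3 and w, leaving rational identities. *)
have r3 : (3 : R) `^ (2 / 3) = (3 `^ (1 / 3)) ^+ 2.
  by rewrite -powR_mulrn ?powR_ge0 // -powRrM; congr (_ `^ _); field.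
have r23 : (2 / 3 : R) `^ (1 / 3) = 2 `^ (1 / 3) / 3 `^ (1 / 3).
  apply: (mulIf (x := 3 `^ (1 / 3))); first by rewrite gt_eqF ?powR_gt0.
  by rewrite -powRM ?divfK ?gt_eqF ?powR_gt0 //; lra.
rewrite r3 r23.
have := pow3 2 (ler0n _ _); have := pow3 3 (ler0n _ _); have := pow3 w (ltW w_gt0).
have : 0 < w `^ (1 / 3) by rewrite powR_gt0.
have : 0 < (2 : R) `^ (1 / 3) by rewrite powR_gt0.
have : 0 < (3 : R) `^ (1 / 3) by rewrite powR_gt0.
move: (w `^ _) (2 `^ _) (3 `^ _) => u e f f_gt0 e_gt0 u_gt0 u3 f3 e3.
have [u0 e0 f0] : [/\ u != 0, e != 0 & f != 0] by rewrite !gt_eqF.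
have v3 : (u / (e * f ^+ 2)) ^+ 3 = w / 18.
  rewrite expr_div_n u3 exprMn e3 -exprM mulnC exprM f3; congr (_ / _); ring.
exists (u / (e * f ^+ 2)); split.
- by rewrite divr_gt0 // mulr_gt0 // exprn_gt0.
- rewrite addrC; congr (_ + _).
  have -> : 3 * (u / (e * f ^+ 2)) = f * u / e.
    by rewrite -{1}f3; field; rewrite e0 f0.
  by field; rewrite u0 e0 f0.
- have w0 : w != 0 by rewrite gt_eqF.
  rewrite v3; apply: (mulIf w0); rewrite mul0r.
  (* The equation becomes w^2 - 18 Q w + 12 P^3 = 0, of which 9 Q + S is a root. *)
  have -> : (w / 18 - Q + P ^+ 3 / (27 * (w / 18))) * w
     = w ^+ 2 / 18 - Q * w + 2 / 3 * P ^+ 3 by field.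
  have -> : P ^+ 3 = (81 * Q ^+ 2 - S ^+ 2) / 12 by rewrite S2 /D; field.
  by rewrite /w; field.
- by rewrite v3 /w; lra.
Qed.

(* The discriminant condition makes [3 r^2 > 4 p], so the cofactor
   [x^2 + r x + (r^2 - p)] of [x - r] is positive definite. *)
Lemma cardano_rootP (R : realType) (p q : int) : 0 < p -> 0 < q ->
    4 * p ^+ 3 < 27 * q ^+ 2 ->
  let r := cardano_root R p q in
  [/\ 0 < r, r ^+ 3 = p%:~R * r + q%:~R & 4 * p%:~R < 3 * r ^+ 2].
Proof.
move=> p_gt0 q_gt0 lt_pq /=.
have [v [v_gt0 -> v3 ltv]] := cardano_rootE R q_gt0 lt_pq.
have P_gt0 : 0 < p%:~R :> R by rewrite ltr0z.
have Q_gt0 : 0 < q%:~R :> R by rewrite ltr0z.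
have lt_PQ : 4 * p%:~R ^+ 3 < 27 * q%:~R ^+ 2 :> R.
  by move: lt_pq; rewrite -(ltr_int R) 2!intrM 2!rmorphXn.
move: (p%:~R : R) (q%:~R : R) P_gt0 Q_gt0 lt_PQ v3 ltv => P Q P_gt0 Q_gt0 lt_PQ v3 ltv.
have v0 : v != 0 by rewrite gt_eqF.
split.
- by rewrite addr_gt0 // divr_gt0 // mulr_gt0.
- apply/eqP; rewrite -subr_eq0 -v3; apply/eqP; field.
  by rewrite v0.
(* P^3 < 27 Q^2 / 4 < 27 v^6, so P differs from 3 v^2 and the square below is nonzero. *)
- have lt_Pv : P ^+ 3 < (3 * v ^+ 2) ^+ 3.
    have -> : (3 * v ^+ 2) ^+ 3 = 27 * (v ^+ 3) ^+ 2 by ring.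
    nra.
  have {}lt_Pv : P < 3 * v ^+ 2.
    by move: lt_Pv; rewrite ltr_pXn2r // nnegrE ?mulr_ge0 ?sqr_ge0 ?ltW.
  rewrite -subr_gt0.
  have -> : 3 * (v + P / (3 * v)) ^+ 2 - 4 * P = (3 * v ^+ 2 - P) ^+ 2 / (3 * v ^+ 2).
    by field; rewrite v0.
  by rewrite divr_gt0 ?exprn_gt0 ?mulr_gt0 ?exprn_gt0 // subr_gt0.
Qed.

Lemma depressed_cubic_root_unique (R : realType) (p q : int) (r : R) :
    r ^+ 3 = p%:~R * r + q%:~R -> 4 * p%:~R < 3 * r ^+ 2 ->
  forall x : R, root (depressed_cubic R p q) x <-> x = r.
Proof.
move=> r3 lt_pr x.
have fE : (depressed_cubic R p q).[x] = (x - r) * (x ^+ 2 + r * x + (r ^+ 2 - p%:~R)).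
  transitivity (x ^+ 3 - p%:~R * x - q%:~R); first by rewrite /depressed_cubic !hornerE.
  have -> : q%:~R = r ^+ 3 - p%:~R * r by rewrite r3; ring.
  by ring.
rewrite rootE fE mulf_eq0 subr_eq0 [X in _ || X]gt_eqF ?orbF; first by split=> /eqP.
(* The cofactor equals (x + r/2)^2 + (3 r^2 - 4 p)/4. *)
by have := sqr_ge0 (x + r / 2); nra.
Qed.

Theorem theorem4 (R : realType) (p q : int) (hp : 0 < p) (hq : 0 < q)
    (hpq : 0 < 27 * q ^+ 2 - 4 * p ^+ 3) :
  let u : R^nat := fun n => (cubic_seq p q n.+1)%:~R / (cubic_seq p q n)%:~R in
  [/\ cvgn u,
      -1 + limn u = cardano_root R p q
    & forall x : R, root (depressed_cubic R p q) x <-> x = cardano_root R p q].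
Proof.
move=> u; have lt_pq : 4 * p ^+ 3 < 27 * q ^+ 2 by rewrite -subr_gt0.
have [r_gt0 r3 lt_pr] := cardano_rootP R hp hq lt_pq.
have P_gt0 : 0 < p%:~R :> R by rewrite ltr0z.
set r := cardano_root R p q in r_gt0 r3 lt_pr *.
have u_lim : u @ \oo --> r + 1.
  have [a0 a1 a2] := cubic_seq_init p q.
  (* The cofactor x^2 + r x + r^2 - p at x = y - 1 is y^2 - (2 - r) y + (r^2 - p - r + 1). The
     discriminant condition reduces to 4 p < 3 r^2, the dominance to -p < 3 r. *)
  apply: (@dominant_root_ratio R (fun n => (cubic_seq p q n)%:~R) (r + 1)
    (2 - r) (r ^+ 2 - p%:~R - r + 1)); [lra | nra | nra | move=> n |].
  - rewrite cubic_seq_rec !rmorphD !rmorphM /= !rmorphD !rmorphN /=.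
    have -> : q%:~R = r ^+ 3 - p%:~R * r by rewrite r3; ring.
    by ring.
  - rewrite a0 a1 a2; set L := (X in X != 0).
    have -> : L = (r + 1) ^+ 2 by rewrite /L; ring.
    by rewrite expf_neq0 // gt_eqF // addr_gt0.
split; last exact: depressed_cubic_root_unique.
- by apply/cvg_ex; exists (r + 1).
- by rewrite (cvg_lim _ u_lim) //; ring.
Qed.
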